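(* For $i,j\in\{2,\infty\}$ and $n,m\ge1$, let $\mathsf b_{i,j}(n,m)=\dim_\Bbbk B_{i,j}(n,m)$. Then for all $n,m\ge1$: \begin{align*} \mathsf b_{2,\infty}(n,m)&=\mathrm{BT}\bigl(\mathsf b_{2,2}(n,\cdot)\bigr)(m),\\ \mathsf b_{\infty,2}(n,m)&=\mathrm{BT}\bigl(\mathsf b_{2,2}(\cdot,m)\bigr)(n),\\ \mathsf b_{\infty,\infty}(n,m)&=\mathrm{BT}^2(\mathsf b_{2,2})(n,m)=\mathrm{BT}\bigl(\mathsf b_{2,\infty}(\cdot,m)\bigr)(n)=\mathrm{BT}\bigl(\mathsf b_{\infty,2}(n,\cdot)\bigr)(m). \end{align*}
   Context: \textbf{Decorated trees.} In a rooted planar tree, a node is a leaf if it has no children and internal otherwise; an angle is the sector between two consecutive children of an internal node. $\mathcal T_{\infty,\infty}$ is the set of finite rooted planar trees having at least one internal node, with each angle labeled by a positive integer and each internal node labeled by a nonnegative integer, such that: every internal node has at least two children; among the children of each node, only the leftmost and rightmost can be leaves; only the root may have label $0$. $\mathcal T_{\infty,2}$ is the subset of trees all of whose internal node labels are $\le 1$; $\mathcal T_{2,\infty}$ is the subset of trees all of whose angle labels are $1$; $\mathcal T_{2,2}=\mathcal T_{\infty,2}\cap\mathcal T_{2,\infty}$. $\deg_{\mathrm{node}}(t)$ is the sum of the internal node labels of $t$ and $\deg_{\mathrm{angle}}(t)$ the sum of its angle labels. $\mathcal T_{i,j}(n,m)=\{t\in\mathcal T_{i,j}:\deg_{\mathrm{angle}}(t)=n,\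 \deg_{\mathrm{node}}(t)=m\}$, and $B_{i,j}(n,m)$ is the free $\Bbbk$-module with basis $\mathcal T_{i,j}(n,m)$ ($\Bbbk$ a commutative ring), so that its dimension (rank) $\mathsf b_{i,j}(n,m)$ is the cardinality of $\mathcal T_{i,j}(n,m)$. ($B_{i,j}(n,m)$ is the homogeneous component of bidegree $(n,m)$ of the underlying space of a free Baxter algebra on one generator.) \textbf{Binomial transforms.} For sequences $a(n)$, $b(n,m)$ defined for $n,m\ge1$, $$\mathrm{BT}(a)(n)=\sum_{k=1}^n\binom{n-1}{k-1}a(k),\qquad\mathrm{BT}^2(b)(n,m)=\sum_{k=1}^n\sum_{\ell=1}^m\binom{n-1}{k-1}\binom{m-1}{\ell-1}b(k,\ell).$$ *)

(* Defs.v *)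
From HB Require Import structures.
From mathcomp Require Import all_boot all_order all_algebra.
From mathcomp Require Import boolp classical_sets.
From mathcomp Require Import freeg.
From mathcomp Require Import zify.

Set Implicit Arguments.
Unset Strict Implicit.
Unset Printing Implicit Defensive.

Import GRing.Theory.

(* [Node l t0 [:: (a1, t1); ...; (ar, tr)]] is an internal node with label l
   and children t0, t1, ..., tr from left to right; a_i labels the angle
   between t_(i-1) and t_i. *)
Inductive tree : Type :=
| Leaf
| Node of nat & tree & seq (nat * tree).

Fixpoint tree_encode (t : tree) : GenTree.tree nat :=
  match t with
  | Leaf => GenTree.Leaf 0
  | Node l t0 s =>
      GenTree.Node l
        (tree_encode t0
           :: [seq GenTree.Node p.1 [:: tree_encode p.2] | p <- s])
  end.

Fixpoint tree_decode (g : GenTree.tree nat) : tree :=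
  match g with
  | GenTree.Node l (g0 :: s) =>
      Node l (tree_decode g0)
        [seq (if h is GenTree.Node a [:: g'] then (a, tree_decode g')
              else (0, Leaf)) | h <- s]
  | _ => Leaf
  end.

Fixpoint tree_nested_ind (P : tree -> Prop) (HL : P Leaf)
    (HN : forall l t0 s,
       P t0 -> foldr (fun p Q => P p.2 /\ Q) True s -> P (Node l t0 s))
    (t : tree) {struct t} : P t.
Proof.
case: t => [|l t0 s]; first exact: HL.
apply: (HN); first exact: (tree_nested_ind P HL HN t0).
elim: s => //= p s IHs; split => //.
exact: (tree_nested_ind P HL HN p.2).
Defined.

Lemma tree_encodeK : cancel tree_encode tree_decode.
Proof.
elim/tree_nested_ind => [//|l t0 s /= -> IHs]; congr Node.
by elim: s IHs => [//|[a t] s IH] /= [-> /IH ->].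
Qed.

HB.instance Definition _ := Countable.copy tree (can_type tree_encodeK).

Definition is_internal (t : tree) : bool := if t is Node _ _ _ then true else false.

(* Preorder, so that the label of the root comes first. *)
Fixpoint node_labels (t : tree) : seq nat :=
  if t is Node l t0 s
  then l :: node_labels t0 ++ flatten [seq node_labels p.2 | p <- s]
  else [::].

Fixpoint angle_labels (t : tree) : seq nat :=
  if t is Node _ t0 s
  then [seq p.1 | p <- s]
         ++ angle_labels t0 ++ flatten [seq angle_labels p.2 | p <- s]
  else [::].

Definition deg_node (t : tree) : nat := sumn (node_labels t).
Definition deg_angle (t : tree) : nat := sumn (angle_labels t).

(* Every internal node has at least two children, and its children other than
   the leftmost and the rightmost one are internal. *)
Fixpoint well_branched (t : tree) : bool :=
  if t is Node _ t0 s
  then [&& s != [::],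
           all is_internal (behead (belast t0 [seq p.2 | p <- s])),
           well_branched t0
         & all (fun p => well_branched p.2) s]
  else true.

Definition decorated_tree (t : tree) : bool :=
  [&& is_internal t,
      well_branched t,
      all (fun a => 0 < a) (angle_labels t)
    & all (fun l => 0 < l) (behead (node_labels t))].

Inductive bound : Type := Two | Infty.

(* The first index bounds the angle labels, the second one the node labels. *)
Definition in_T (i j : bound) (t : tree) : bool :=
  [&& decorated_tree t,
      (if i is Two then all (fun a => a == 1) (angle_labels t) else true)
    & (if j is Two then all (fun l => l <= 1) (node_labels t) else true)].

Definition in_T_bidegree (i j : bound) (n m : nat) (t : tree) : bool :=
  [&& in_T i j t, deg_angle t == n & deg_node t == m].

Definition T (i j : bound) (n m : nat) : Type :=
  {t : tree | in_T_bidegree i j n m t}.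
HB.instance Definition _ i j n m := Choice.on (T i j n m).

Definition B (k : comNzRingType) (i j : bound) (n m : nat) : lmodType k :=
  {freeg (T i j n m) / k}.

Section Rank.
Local Open Scope ring_scope.
Variables (k : comNzRingType) (V : lmodType k).

Definition free_of_rank (d : nat) : Prop :=
  exists e : 'I_d -> V,
    forall v : V, exists! c : 'rV[k]_d, v = \sum_i c 0 i *: e i.

(* The value is 0 if V is not free of finite rank; by [B_free] below this never
   happens for the modules B. *)
Definition rank : nat := xget 0%N [set d | free_of_rank d]%classic.

End Rank.

Definition b (k : comNzRingType) (i j : bound) (n m : nat) : nat :=
  rank (B k i j n m).

Definition BT (a : nat -> nat) (n : nat) : nat :=
  \sum_(1 <= k < n.+1) 'C(n.-1, k.-1) * a k.

Definition BT2 (c : nat -> nat -> nat) (n m : nat) : nat :=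
  \sum_(1 <= k < n.+1) \sum_(1 <= l < m.+1)
    'C(n.-1, k.-1) * 'C(m.-1, l.-1) * c k l.

Section RankTheory.
Local Open Scope ring_scope.
Variables (k : comNzRingType) (V : lmodType k).

Lemma free_of_rank_le (d d' : nat) :
  free_of_rank V d -> free_of_rank V d' -> (d <= d')%N.
Proof.
case=> e He [e' He'].
have [A HA] : exists A : 'M[k]_(d, d'), forall i, e i = \sum_j A i j *: e' j.
  have /choice[f Hf] i : exists c : 'rV[k]_d', e i = \sum_j c 0 j *: e' j.
    by have [c [Hc _]] := He' (e i); exists c.
  exists (\matrix_(i, j) f i 0 j) => i; rewrite {1}Hf.
  by apply: eq_bigr => j _; rewrite mxE.
have [A' HA'] : exists A : 'M[k]_(d', d), forall i, e' i = \sum_j A i j *: e j.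
  have /choice[f Hf] i : exists c : 'rV[k]_d, e' i = \sum_j c 0 j *: e j.
    by have [c [Hc _]] := He (e' i); exists c.
  exists (\matrix_(i, j) f i 0 j) => i; rewrite {1}Hf.
  by apply: eq_bigr => j _; rewrite mxE.
apply: (@mulmx1_min _ _ _ A A'); apply/row_matrixP => i.
have [c [_ Hc]] := He (e i).
have <- : c = row i (A *m A').
  apply: Hc; rewrite {1}HA.
  under eq_bigr => l _ do rewrite HA' scaler_sumr.
  rewrite exchange_big /=; apply: eq_bigr => j _.
  rewrite !mxE scaler_suml.
  by apply: eq_bigr => l _; rewrite scalerA.
apply: Hc; rewrite (bigD1 i) //= big1 ?addr0 => [|j ne_ji].
  by rewrite !mxE eqxx scale1r.
by rewrite !mxE eq_sym (negbTE ne_ji) scale0r.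
Qed.

Lemma rankP (d : nat) : free_of_rank V d -> rank V = d.
Proof.
move=> Hd; apply: xget_unique => //= d' Hd'.
by apply/eqP; rewrite eqn_leq !free_of_rank_le.
Qed.

End RankTheory.

Section FreeModule.
Local Open Scope ring_scope.

Lemma freeg_free (k : comNzRingType) (X : choiceType) (s : seq X) :
  uniq s -> (forall x, x \in s) -> free_of_rank {freeg X / k} (size s).
Proof.
move=> us alls; exists (fun i => << tnth (in_tuple s) i >>) => v.
have coeffS (c : 'rV[k]_(size s)) i :
    coeff (tnth (in_tuple s) i)
      (\sum_j c 0 j *: << tnth (in_tuple s) j >> : {freeg X / k}) = c 0 i.
  rewrite raddf_sum /= (bigD1 i) //= big1 ?addr0 => [|j ne_ji].
    by rewrite coeffZ coeffU eqxx !mulr1.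
  rewrite coeffZ coeffU (_ : (_ == _) = false) ?mulr0 //.
  by apply: contraNF ne_ji => /eqP/(tuple_uniqP (in_tuple s) us) ->.
exists (\row_i coeff (tnth (in_tuple s) i) v); split=> [|c ->].
  apply/eqP/freeg_eqP => x /=.
  have /tnthP[i ->] : x \in in_tuple s by exact: alls.
  by rewrite coeffS mxE.
by apply/rowP => i; rewrite mxE coeffS.
Qed.

End FreeModule.

Fixpoint tree_size (t : tree) : nat :=
  if t is Node l t0 s
  then (l + tree_size t0 + sumn [seq p.1 + tree_size p.2 | p <- s]).+1
  else 1.

Lemma bounded_trees (N : nat) :
  exists s : seq tree, forall t, tree_size t <= N -> t \in s.
Proof.
elim: N => [|N [s Hs]]; first by exists [::] => -[].
have [r Hr] : exists r : seq (seq (nat * tree)),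
    forall q, sumn [seq p.1 + tree_size p.2 | p <- q] <= N -> q \in r.
  have H M : exists r : seq (seq (nat * tree)), forall q, size q <= M ->
      sumn [seq p.1 + tree_size p.2 | p <- q] <= N -> q \in r.
    elim: M => [|M [r Hr]]; first by exists [:: [::]] => -[].
    exists ([::] :: [seq p :: q | p <- [seq (a, t) | a <- iota 0 N.+1, t <- s],
                                  q <- r]) => -[//|[a t] q] szq sumq.
    rewrite /= in szq sumq.
    rewrite inE; apply/orP; right; apply/allpairsP; exists ((a, t), q).
    split=> //; last by apply: Hr => //=; lia.
    apply/allpairsP; exists (a, t); split=> //; last by apply: Hs => /=; lia.
    by rewrite mem_iota /=; lia.
  have [r Hr] := H N; exists r => q Hq; apply: Hr => //.
  apply: leq_trans Hq; elim: q => //= -[a t] q IH /=.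
  by rewrite -add1n leq_add // addn_gt0; case: t => *; rewrite orbT.
exists (Leaf :: [seq Node x.1.1 x.1.2 x.2 |
   x <- [seq (y, q) | y <- [seq (l, t) | l <- iota 0 N.+1, t <- s], q <- r]]).
case=> [_|l t q Hq]; first by rewrite inE eqxx.
rewrite /= ltnS in Hq; rewrite inE; apply/orP; right.
apply/mapP; exists ((l, t), q) => //.
apply/allpairsP; exists ((l, t), q); split=> //; last by apply: Hr => /=; lia.
apply/allpairsP; exists (l, t); split=> //; last by apply: Hs => /=; lia.
by rewrite mem_iota /=; lia.
Qed.

Lemma tree_size_le (t : tree) :
  well_branched t -> all (fun a => 0 < a) (angle_labels t) ->
  tree_size t <= 3 * deg_angle t + deg_node t + 1.
Proof.
rewrite /deg_angle /deg_node.
elim/tree_nested_ind: t => [//|l t0 s IH0 IHs] /=.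
case/and4P=> s0 _ w0 ws; rewrite !all_cat !sumn_cat => /and3P[a1 a0 as_].
have {w0 a0}IH0 := IH0 w0 a0.
suff : sumn [seq p.1 + tree_size p.2 | p <- s] + size s <=
    3 * (sumn [seq p.1 | p <- s] + sumn (flatten [seq angle_labels p.2 | p <- s]))
    + sumn (flatten [seq node_labels p.2 | p <- s]).
  have : 0 < size s by case: (s) s0.
  lia.
elim: s {s0} IHs ws a1 as_ => //= -[a t] s IH /= [IHt IHs] /andP[wt ws].
case/andP=> a_gt0 a1; rewrite all_cat !sumn_cat => /andP[at_ as_].
have := IH IHs ws a1 as_; have := IHt wt at_.
lia.
Qed.

Lemma T_finite (i j : bound) (n m : nat) :
  exists s : seq (T i j n m), uniq s /\ forall t, t \in s.
Proof.
have [s Hs] := bounded_trees (3 * n + m + 1).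
exists (undup (pmap insub s)); split=> [|t]; first exact: undup_uniq.
rewrite mem_undup mem_pmap_sub; apply: Hs.
case/and3P: (valP t) => /and3P[/and4P[_ wt at_ _] _ _] /eqP dn /eqP dm.
by have := tree_size_le wt at_; rewrite dn dm.
Qed.

Lemma B_free (k : comNzRingType) (i j : bound) (n m : nat) :
  free_of_rank (B k i j n m) (b k i j n m).
Proof.
have [s [us alls]] := T_finite i j n m.
have Hs : free_of_rank (B k i j n m) (size s) by exact: freeg_free.
by rewrite /b (rankP Hs).
Qed.

(* Main.v *)
Require Import Defs.
From mathcomp Require Import all_boot all_algebra.
From mathcomp Require Import boolp zify.

(** A tree is the same thing as its underlying unlabeled tree together with two
    words, the word of its node labels and the word of its angle labels, which
    can be chosen freely except for their lengths ([tree_inj], [tree_relabel]).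
    The conditions that define the decorated trees see each of these words only
    through its pattern, that is, through the positions of its zeros.

    So replace every nonzero node label by 1.  The trees of node degree [m] that
    are sent to a given tree with [k] nonzero labels correspond to the words of
    sum [m] with a prescribed pattern having [k] nonzero positions, that is, to
    the compositions of [m] into [k] parts; there are ['C(m.-1, k.-1)] of them
    ([size_fillings]), and [0 < m] forces [0 < k].  Summing over [k] expresses
    the count without bound on the node labels as the binomial transform of the
    count for node labels at most 1, whatever the bound on the angle labels.
    The same argument applies to the angle labels, for which the pattern has no
    zero.  Both are instances of [size_relabelings].  The double transform comes
    from using the two in succession, in either order. *)

Set Implicit Arguments.
Unset Strict Implicit.
Unset Printing Implicit Defensive.

(** * Words with a prescribed pattern of zeros *)

Definition pattern (w : seq nat) : bitseq := [seq 0 < a | a <- w].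

(** The words of pattern [p] and sum [m].  In the last case, [j] is the sum of
    what follows the first letter. *)
Fixpoint fillings (p : bitseq) (m : nat) : seq (seq nat) :=
  match p with
  | [::] => if m == 0 then [:: [::]] else [::]
  | false :: p' => [seq 0 :: w | w <- fillings p' m]
  | true :: p' => [seq (m - j) :: w | j <- iota 0 m, w <- fillings p' j]
  end.

Lemma mem_fillings (p : bitseq) (m : nat) (w : seq nat) :
  (w \in fillings p m) = (pattern w == p) && (sumn w == m).
Proof.
elim: p m w => [|c p IH] m w /=.
  by case: w => [|a w]; case: m => [|m] //=; rewrite in_nil.
case: c.
  apply/allpairsPdep/andP => [[j [w' [+ + ->]]]|[+ /eqP <-]].
    rewrite mem_iota IH => /andP[_ lt_jm] /andP[/eqP <- /eqP sw] /=.
    by rewrite subn_gt0 lt_jm sw subnK ?eqxx // ltnW.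
  case: w => [//|a w] /= /eqP[a_gt0 eq_p].
  exists (sumn w), w; split; last by rewrite addnK.
    by rewrite mem_iota /=; lia.
  by rewrite IH eq_p !eqxx.
apply/mapP/andP => [[w' + ->]|[+ sw]].
  by rewrite IH => /andP[/eqP <- /eqP <-].
case: w sw => [//|[|a] w] //= sw /eqP[eq_p].
by exists w; rewrite // IH eq_p eqxx.
Qed.

Lemma fillings_uniq (p : bitseq) (m : nat) : uniq (fillings p m).
Proof.
elim: p m => [|[] p IH] m /=; first by case: ifP.
  apply: allpairs_uniq_dep; rewrite ?iota_uniq // => -[j w] [j' w'].
  move=> /allpairsPdep[a [v [+ + [-> ->]]]] /allpairsPdep[a' [v' [+ + [-> ->]]]].
  rewrite !mem_fillings => _ /andP[_ /eqP sv] _ /andP[_ /eqP sv'] [_ eq_v].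
  by rewrite -sv -sv' eq_v.
by rewrite map_inj_uniq // => w w' [].
Qed.

Lemma sum_bin_diag (m k : nat) : \sum_(0 <= i < m) 'C(i, k) = 'C(m, k.+1).
Proof.
by elim: m => [|m IH]; [rewrite big_geq | rewrite big_nat_recr //= IH binS].
Qed.

(** Deleting the zeros, whose positions are prescribed, turns these words into
    the compositions of [m] into as many parts as [p] has nonzero positions. *)
Lemma size_fillings (p : bitseq) (m : nat) : 0 < m -> 0 < count id p ->
  size (fillings p m) = 'C(m.-1, (count id p).-1).
Proof.
have size0 q : size (fillings q 0) = (count id q == 0).
  by elim: q => [|[] q IH] //=; rewrite size_map.
case: m => // m _.
suff -> : size (fillings p m.+1) =
    if count id p is k.+1 then 'C(m, k) else 0 by case: count.
elim: p m => [//|[] p IH] m; last by rewrite /= size_map IH.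
change (size [seq (m.+1 - j) :: w | j <- index_iota 0 m.+1, w <- fillings p j]
        = 'C(m, count id p)).
rewrite size_allpairs_dep sumnE big_map big_nat_recl // size0.
under eq_bigr do rewrite IH.
case: (count id p) => [|k]; first by rewrite big1 // bin0.
by rewrite sum_bin_diag.
Qed.

Lemma sumn_pattern (w : seq nat) :
  all (fun a => a <= 1) w -> count id (pattern w) = sumn w.
Proof. by elim: w => [|[|[|a]] w IH] //= /IH ->. Qed.

Lemma pattern_inj_le1 (v w : seq nat) :
  all (fun a => a <= 1) v -> all (fun a => a <= 1) w ->
  pattern v = pattern w -> v = w.
Proof.
elim: v w => [|a v IH] [|a' w] //= /andP[a1 v1] /andP[a1' w1] [eq_a eq_v].
by rewrite (IH w v1 w1 eq_v); congr cons; lia.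
Qed.

(** * Relabeling structures *)

Section Relabeling.

(** Objects [t] carrying a word [lab t] that can be changed at will, given the
    remaining data [rest t]; the property [P] sees only its zeros. *)
Variables (X : choiceType) (Y : Type) (rest : X -> Y) (lab : X -> seq nat).
Variable P : pred X.
Hypothesis lab_inj : forall t t', rest t = rest t' -> lab t = lab t' -> t = t'.
Hypothesis lab_surj : forall t w, size w = size (lab t) ->
  exists t', rest t' = rest t /\ lab t' = w.
Hypothesis P_pattern : forall t t',
  rest t = rest t' -> pattern (lab t) = pattern (lab t') -> P t = P t'.

(** Every object with [P] and label sum [m] is obtained in a unique way from an
    object with [P] and labels at most 1, by refilling its pattern. *)
Lemma size_relabelings (S : seq X) (U : nat -> seq X) (m : nat) : 0 < m ->
    uniq S -> (forall t, (t \in S) = P t && (sumn (lab t) == m)) ->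
    (forall k, uniq (U k)) ->
    (forall k t, (t \in U k) =
       [&& P t, all (fun a => a <= 1) (lab t) & sumn (lab t) == k]) ->
  size S = BT (fun k => size (U k)) m.
Proof.
move=> m_gt0 uS memS uU memU.
have [relab relabP] : exists relab : X -> seq nat -> X, forall t w,
    pattern w = pattern (lab t) ->
    rest (relab t w) = rest t /\ lab (relab t w) = w.
  have /choice[f fP] (tw : X * seq nat) : exists t',
      pattern tw.2 = pattern (lab tw.1) -> rest t' = rest tw.1 /\ lab t' = tw.2.
    have [eq_p|ne_p] := pselect (pattern tw.2 = pattern (lab tw.1)); last first.
      by exists tw.1.
    have /lab_surj[t' ?] : size tw.2 = size (lab tw.1).
      by rewrite -(size_map (fun a => 0 < a)) -/(pattern _) eq_p size_map.
    by exists t'.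
  by exists (fun t w => f (t, w)) => t w; exact: fP (t, w).
(* The objects to be refilled: [0 < m] excludes the label sum 0. *)
pose V := [seq u | k <- index_iota 1 m.+1, u <- U k].
have memV t : (t \in V) =
    [&& P t, all (fun a => a <= 1) (lab t) & 0 < sumn (lab t) <= m].
  apply/allpairsPdep/and3P => [[k [u [+ + ->]]]|[Pt t1 tm]].
    by rewrite mem_index_iota memU => k_le /and3P[-> -> /eqP ->].
  exists (sumn (lab t)), t; split=> //; first by rewrite mem_index_iota.
  by rewrite memU Pt t1 eqxx.
have uV : uniq V.
  apply: allpairs_uniq_dep; rewrite ?iota_uniq // => -[k u] [k' u'].
  move=> /allpairsPdep[a [v [_ + [-> ->]]]] /allpairsPdep[a' [v' [_ + [-> ->]]]].
  by rewrite !memU => /and3P[_ _ /eqP <-] /and3P[_ _ /eqP <-] /= ->.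
pose E := [seq relab u w | u <- V, w <- fillings (pattern (lab u)) m].
have uE : uniq E.
  apply: allpairs_uniq_dep => // [u _|]; first exact: fillings_uniq.
  move=> [u w] [u' w'] /allpairsPdep[v [x [+ + [-> ->]]]].
  move=> + + /allpairsPdep[v' [x' [+ + [-> ->]]]] => {u w u' w'}.
  rewrite !memV !mem_fillings /=.
  move=> /and3P[_ v1 _] /andP[/eqP px _] /and3P[_ v1' _] /andP[/eqP px' _] eq_r.
  have [rx lx] := relabP _ _ px; have [rx' lx'] := relabP _ _ px'.
  have eq_x : x = x' by rewrite -lx eq_r lx'.
  have -> : v = v'; last by rewrite eq_x.
  apply: lab_inj; first by rewrite -rx eq_r rx'.
  by apply: pattern_inj_le1 => //; rewrite -px -px' eq_x.
have memE : S =i E.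
  move=> t; rewrite memS; apply/andP/allpairsPdep => [[Pt /eqP tm]|].
    (* The object it comes from has every nonzero label replaced by 1. *)
    pose w := [seq nat_of_bool c | c <- pattern (lab t)].
    have pw : pattern w = pattern (lab t).
      by rewrite /w /pattern -map_comp; apply: map_id_in => -[].
    have [ru lu] := relabP t w pw; pose u := relab t w.
    have w1 : all (fun a => a <= 1) w by apply/allP => _ /mapP[[] _ ->].
    have sw : 0 < sumn w <= m.
      suff [-> le_w] : (0 < sumn w) = (0 < sumn (lab t)) /\ sumn w <= sumn (lab t).
        by rewrite -tm le_w tm m_gt0.
      by rewrite /w; elim: (lab t) => [|[|a] s [IH1 IH2]] //=; split; lia.
    exists u, (lab t); split.
    - by rewrite memV lu w1 sw -(P_pattern (t := t)) ?Pt // lu pw.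
    - by rewrite mem_fillings lu pw tm !eqxx.
    - have [rt lt] : rest (relab u (lab t)) = rest u /\
          lab (relab u (lab t)) = lab t by apply: relabP; rewrite lu pw.
      by apply: lab_inj; rewrite ?rt ?lt.
  move=> [u [w [+ + ->]]]; rewrite memV mem_fillings.
  move=> /and3P[Pu _ _] /andP[/eqP pw sw]; have [rw lw] := relabP _ _ pw.
  by rewrite lw sw (P_pattern (t' := u)) ?lw.
rewrite (perm_size (uniq_perm uS uE memE)) size_allpairs_dep sumnE big_map.
rewrite big_allpairs_dep /= big_seq /BT [RHS]big_seq; apply: eq_bigr => k.
rewrite mem_index_iota => /andP[k_gt0 _].
rewrite mulnC -[size (U k)]count_predT -sum1_count big_distrl /=.
rewrite big_seq [RHS]big_seq; apply: eq_bigr => u.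
rewrite memU => /and3P[_ u1 /eqP uk].
by rewrite size_fillings ?sumn_pattern ?uk // mul1n.
Qed.

End Relabeling.

(** * Trees as shapes with two words of labels *)

Fixpoint shape (t : tree) : tree :=
  if t is Node _ t0 s then Node 0 (shape t0) [seq (0, shape p.2) | p <- s]
  else Leaf.

Lemma is_internal_shape (t : tree) : is_internal (shape t) = is_internal t.
Proof. by case: t. Qed.

Lemma well_branched_shape (t : tree) :
  well_branched (shape t) = well_branched t.
Proof.
elim/tree_nested_ind: t => [//|l t0 s IH0 IHs] /=; rewrite IH0.
congr [&& _, _, _ & _]; first by case: (s).
- rewrite -map_comp -[map _ s]/(map (shape \o snd) s) map_comp.
  have -> (t : tree) r : belast (shape t) (map shape r) = map shape (belast t r).
    by elim: r t => //= t' r IH t; rewrite IH.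
  rewrite behead_map all_map.
  by apply: eq_all => t /=; rewrite is_internal_shape.
- by elim: s IHs => //= p s IH [-> /IH ->].
Qed.

Lemma size_labels_shape (t : tree) :
  size (node_labels (shape t)) = size (node_labels t) /\
  size (angle_labels (shape t)) = size (angle_labels t).
Proof.
elim/tree_nested_ind: t => [//|l t0 s [IHn IHa] IHs] /=.
rewrite !size_cat !size_map IHn IHa.
suff [-> ->] : size (flatten [seq node_labels p.2 | p <- [seq (0, shape p.2) | p <- s]])
      = size (flatten [seq node_labels p.2 | p <- s]) /\
    size (flatten [seq angle_labels p.2 | p <- [seq (0, shape p.2) | p <- s]])
      = size (flatten [seq angle_labels p.2 | p <- s]) by [].
elim: s IHs => //= p s IH [[eqn eqa] /IH[eqns eqas]].
by rewrite !size_cat eqn eqa eqns eqas.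
Qed.

Lemma cat_inj_size (A : Type) (s1 s2 r1 r2 : seq A) :
  size s1 = size s2 -> s1 ++ r1 = s2 ++ r2 -> s1 = s2 /\ r1 = r2.
Proof. by elim: s1 s2 => [|a s1 IH] [|a' s2] //= [/IH eq_s] [-> /eq_s[-> ->]]. Qed.

Lemma size_labels_eq (t t' : tree) : shape t = shape t' ->
  size (node_labels t) = size (node_labels t') /\
  size (angle_labels t) = size (angle_labels t').
Proof.
move=> eq_sh; have [<- <-] := size_labels_shape t.
by rewrite eq_sh; exact: size_labels_shape.
Qed.

(** Equal shapes force corresponding subtrees to carry words of equal lengths,
    so the words of the whole trees, being concatenations, determine those of
    the subtrees. *)
Lemma tree_inj (t t' : tree) : shape t = shape t' ->
  node_labels t = node_labels t' -> angle_labels t = angle_labels t' -> t = t'.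
Proof.
elim/tree_nested_ind: t t' => [|l t0 s IH0 IHs] [|l' t0' s'] //= [sh0 shs].
move=> [-> eqn]; have [szn sza] := size_labels_eq sh0.
have [eqn0 eqns] := cat_inj_size szn eqn.
have szs : size s = size s'.
  by have := congr1 size shs; rewrite !size_map.
move=> /cat_inj_size; rewrite !size_map => /(_ szs)[eqs].
move=> /(cat_inj_size sza)[eqa0 eqas].
rewrite (IH0 t0') //; congr Node.
elim: s s' IHs shs szs eqs eqns eqas {sh0 eqn} => [|[a t] s IH] [|[a' t'] s'] //=.
move=> [IHt IHs] [sht shs] [szs] [-> eqs].
have [sznt szat] := size_labels_eq sht.
move=> /(cat_inj_size sznt)[eqnt eqns] /(cat_inj_size szat)[eqat eqas].
by rewrite (IHt t') // (IH s').
Qed.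

Lemma split_word (A : Type) (w : seq A) (i j : nat) : size w = i + j ->
  exists w1 w2, [/\ w = w1 ++ w2, size w1 = i & size w2 = j].
Proof.
move=> szw; exists (take i w), (drop i w).
by rewrite cat_take_drop size_drop size_takel szw ?leq_addr // addKn.
Qed.

Lemma tree_relabel (t : tree) (v w : seq nat) :
    size v = size (node_labels t) -> size w = size (angle_labels t) ->
  exists t', [/\ shape t' = shape t, node_labels t' = v & angle_labels t' = w].
Proof.
elim/tree_nested_ind: t v w => [|l t0 s IH0 IHs] v w /=.
  by move=> /size0nil -> /size0nil ->; exists Leaf.
case: v => // l' v; rewrite !size_cat size_map => -[].
move=> /split_word[v0 [vs [-> szv0 szvs]]].
move=> /split_word[a [ws' [-> sza]]] /split_word[w0 [ws [-> szw0 szws]]].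
have [t0' [sh0 <- <-]] := IH0 _ _ szv0 szw0.
suff [s' [shs eqa eqn eqw]] : exists s' : seq (nat * tree),
    [/\ [seq (0, shape p.2) | p <- s'] = [seq (0, shape p.2) | p <- s],
        [seq p.1 | p <- s'] = a,
        flatten [seq node_labels p.2 | p <- s'] = vs
      & flatten [seq angle_labels p.2 | p <- s'] = ws].
  by exists (Node l' t0' s'); rewrite /= sh0 shs eqa eqn eqw.
elim: s IHs vs ws a szvs szws sza {ws' v0 w0 szv0 szw0 sh0}
  => [_|[b t] s IH /= [IHt IHs]] vs ws a.
  by move=> /size0nil -> /size0nil -> /size0nil ->; exists [::].
rewrite !size_cat => /split_word[v1 [v2 [-> szv1 szv2]]].
move=> /split_word[w1 [w2 [-> szw1 szw2]]].
case: a => // b' a [sza].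
have [t' [sht <- <-]] := IHt _ _ szv1 szw1.
have [s' [shs <- <- <-]] := IH IHs _ _ _ szv2 szw2 sza.
by exists ((b', t') :: s'); rewrite /= sht shs.
Qed.

(** * Ranks as numbers of trees *)

Lemma rank_enum (k : comNzRingType) (i j : bound) (n m : nat) (s : seq tree) :
  uniq s -> s =i in_T_bidegree i j n m -> b k i j n m = size s.
Proof.
move=> us mems; pose s' : seq (T i j n m) := pmap insub s.
have -> : size s = size s'.
  rewrite size_pmap_sub -size_filter; congr size.
  by apply/esym/all_filterP/allP => t; rewrite mems.
apply/rankP/freeg_free; first exact: pmap_sub_uniq.
by move=> t; rewrite mem_pmap_sub mems; exact: valP.
Qed.

Lemma tree_enum (i j : bound) (n m : nat) :
  exists s : seq tree, uniq s /\ s =i in_T_bidegree i j n m.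
Proof.
have [s [us alls]] := T_finite i j n m.
exists (map val s); split=> [|t]; first by rewrite map_inj_uniq //; exact: val_inj.
apply/mapP/idP => [[u _ ->]|Tt]; first exact: valP.
by exists (Sub t Tt : T i j n m).
Qed.

(** * The two binomial transforms *)

Lemma all_pos_pattern (w : seq nat) :
  all (fun a => 0 < a) w = all id (pattern w).
Proof. by rewrite all_map. Qed.

(** The root is the only node that may have label 0, but this is a condition on
    the pattern of the node labels. *)
Lemma rank_node_transform (k : comNzRingType) (i : bound) (n m : nat) : 0 < m ->
  b k i Infty n m = BT (fun m' => b k i Two n m') m.
Proof.
move=> m_gt0; have [S [uS memS]] := tree_enum i Infty n m.
have /choice[U UP] := tree_enum i Two n.
rewrite (rank_enum k uS memS).
rewrite (size_relabelings (U := U) (lab := node_labels)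
  (rest := fun t => (shape t, angle_labels t))
  (P := fun t => in_T i Infty t && (deg_angle t == n)) _ _ _ m_gt0 uS).
- apply: eq_bigr => m' _; congr (_ * _).
  by rewrite (rank_enum k (proj1 (UP m')) (proj2 (UP m'))).
- by move=> t t' [eq_sh eqa] eqn; exact: tree_inj.
- move=> t v szv; have [t' [eq_sh eqn eqa]] := tree_relabel szv (erefl _).
  by exists t'; rewrite eq_sh eqa.
- move=> t t' [eq_sh eqa] eqp; rewrite /in_T /decorated_tree /deg_angle eqa.
  rewrite -(is_internal_shape t) -(well_branched_shape t) eq_sh.
  rewrite is_internal_shape well_branched_shape.
  by rewrite !all_pos_pattern /pattern -!behead_map -!/(pattern _) eqp.
- by move=> t; rewrite memS unfold_in /in_T_bidegree /deg_node andbA.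
- by move=> m'; case: (UP m').
- move=> m' t; rewrite (proj2 (UP m')) unfold_in /in_T_bidegree /in_T /deg_node.
  by rewrite andbT -!andbA; do !bool_congr.
Qed.

(** Positive labels have a pattern without zeros, so bounding the angle labels
    by 1 makes them all equal to 1. *)
Lemma rank_angle_transform (k : comNzRingType) (j : bound) (n m : nat) : 0 < n ->
  b k Infty j n m = BT (fun n' => b k Two j n' m) n.
Proof.
move=> n_gt0; have [S [uS memS]] := tree_enum Infty j n m.
have /choice[U UP] := fun n' => tree_enum Two j n' m.
rewrite (rank_enum k uS memS).
rewrite (size_relabelings (U := U) (lab := angle_labels)
  (rest := fun t => (shape t, node_labels t))
  (P := fun t => in_T Infty j t && (deg_node t == m)) _ _ _ n_gt0 uS).
- apply: eq_bigr => n' _; congr (_ * _).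
  by rewrite (rank_enum k (proj1 (UP n')) (proj2 (UP n'))).
- by move=> t t' [eq_sh eqn] eqa; exact: tree_inj.
- move=> t w szw; have [t' [eq_sh eqn eqa]] := tree_relabel (erefl _) szw.
  by exists t'; rewrite eq_sh eqn.
- move=> t t' [eq_sh eqn] eqp; rewrite /in_T /decorated_tree /deg_node eqn.
  rewrite -(is_internal_shape t) -(well_branched_shape t) eq_sh.
  rewrite is_internal_shape well_branched_shape.
  by rewrite !all_pos_pattern eqp.
- move=> t; rewrite memS unfold_in /in_T_bidegree /deg_angle -andbA.
  by rewrite [X in _ && X]andbC.
- by move=> n'; case: (UP n').
- move=> n' t; rewrite (proj2 (UP n')) unfold_in /in_T_bidegree /in_T.
  rewrite /decorated_tree /deg_angle.
  have eq1 : all (fun a => 0 < a) (angle_labels t) ->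
      all (fun a => a == 1) (angle_labels t)
        = all (fun a => a <= 1) (angle_labels t).
    by move=> /allP pos; apply: eq_in_all => a /pos; case: a => [|[]].
  case: (boolP (all (fun a => 0 < a) _)) eq1 => [_ -> //|_ _].
    by rewrite -!andbA; do !bool_congr.
  by rewrite !andbF.
Qed.

Theorem proposition3p6 (k : comNzRingType) (n m : nat) (hn : 1 <= n) (hm : 1 <= m) :
  [/\ b k Two Infty n m = BT (fun m' => b k Two Two n m') m,
      b k Infty Two n m = BT (fun n' => b k Two Two n' m) n
    & [/\ b k Infty Infty n m = BT2 (b k Two Two) n m,
          BT2 (b k Two Two) n m = BT (fun n' => b k Two Infty n' m) n
        & BT (fun n' => b k Two Infty n' m) n
            = BT (fun m' => b k Infty Two n m') m]].
Proof.
have BT2E : BT2 (b k Two Two) n m = BT (fun n' => b k Two Infty n' m) n.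
  apply: eq_bigr => n' _; rewrite rank_node_transform // big_distrr /=.
  by apply: eq_bigr => m' _; rewrite mulnA.
split; [exact: rank_node_transform | exact: rank_angle_transform | split=> //].
  by rewrite BT2E -rank_angle_transform.
by rewrite -rank_angle_transform // rank_node_transform.
Qed.
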